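(* For all finite words $w$ in $\{0,1,2\}$, $$\sum_{j=0}^2\left(b_j^{(w)}-\frac13\right)^2<\frac16,$$ and this inequality is sharp, i.e. the supremum of the left-hand side over all finite words $w$ equals $\frac16$.
   Context: Let $$M_0=\tfrac1{15}\begin{pmatrix}9&0&0\\2&2&-1\\2&-1&2\end{pmatrix},\quad M_1=\tfrac1{15}\begin{pmatrix}2&2&-1\\0&9&0\\-1&2&2\end{pmatrix},\quad M_2=\tfrac1{15}\begin{pmatrix}2&-1&2\\-1&2&2\\0&0&9\end{pmatrix}.$$ For a finite word $w=(w_1,\dots,w_m)$ in $\{0,1,2\}$ let $M_w=M_{w_1}M_{w_2}\cdots M_{w_m}$ (identity for the empty word), and, indexing columns by $0,1,2$, define $$b_j^{(w)}=\frac16+\frac12\cdot\frac{\text{sum of the entries of column } j\text{ of }M_w}{\text{sum of all entries of }M_w},\qquad j=0,1,2.$$ (These are the weights expressing the average of the Radon-Nikodym derivative of an energy measure of harmonic functions with respect to the Kusuoka measure over the cell $F_wSG$ of the Sierpinski gasket as a weighted average of its values at the three boundary vertices of the cell.) *)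

(* Defs.v *)
From mathcomp Require Import all_boot all_order all_algebra.
From mathcomp Require Import all_classical all_reals.

Set Implicit Arguments.
Unset Strict Implicit.
Unset Printing Implicit Defensive.

Import Order.TTheory GRing.Theory Num.Theory.

Local Open Scope ring_scope.

Definition mx3_of_rows (R : realType) (rows : seq (seq R)) : 'M[R]_3 :=
  \matrix_(i < 3, j < 3) nth 0 (nth [::] rows i) j.

Definition M0 (R : realType) : 'M[R]_3 :=
  15^-1 *: mx3_of_rows [:: [:: 9;  0;  0];
                           [:: 2;  2; -1];
                           [:: 2; -1;  2]].

Definition M1 (R : realType) : 'M[R]_3 :=
  15^-1 *: mx3_of_rows [:: [::  2; 2; -1];
                           [::  0; 9;  0];
                           [:: -1; 2;  2]].

Definition M2 (R : realType) : 'M[R]_3 :=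
  15^-1 *: mx3_of_rows [:: [::  2; -1; 2];
                           [:: -1;  2; 2];
                           [::  0;  0; 9]].

Definition M_letter (R : realType) (k : 'I_3) : 'M[R]_3 :=
  nth 0 [:: M0 R; M1 R; M2 R] k.

Definition M_word (R : realType) (w : seq 'I_3) : 'M[R]_3 :=
  \prod_(k <- w) M_letter R k.

(* The denominator is positive for every word: each letter maps the open cone
   s0 s1 + s1 s2 + s2 s0 > 0, s0 + s1 + s2 > 0 of row vectors into itself, and
   the column sums of M_w are (1, 1, 1) M_w.  So the value of x / 0 is never
   used. *)
Definition b (R : realType) (w : seq 'I_3) (j : 'I_3) : R :=
  1 / 6 + 1 / 2 * ((\sum_(i < 3) M_word R w i j)
                   / (\sum_(i < 3) \sum_(l < 3) M_word R w i l)).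

(* Main.v *)
Require Import Defs.
From mathcomp Require Import all_boot all_order all_algebra.
From mathcomp Require Import all_classical all_reals.
From mathcomp Require Import ring lra.

(** Let s be the row vector of column sums of M_w, let S be its total and let
    e2(s) = s0 s1 + s1 s2 + s2 s0.  Since b_j - 1/3 = (s_j / S - 1/3) / 2, and
    the squares of the s_j add up to S^2 - 2 e2(s), the quantity to bound is
    1/6 - e2(s) / (2 S^2) ([spreadE]).  So the strict bound says that e2(s) > 0
    and S <> 0, and sharpness says that e2(s) / S^2 can be made arbitrarily
    small.

    Appending a letter k to w replaces s by s M_k.  The key fact is that each
    M_k is a similarity of the quadratic form e2: it divides it by 25
    ([e2_col_sum_rcons]).  As e2(1, 1, 1) = 3, this gives
    e2(s) = 3 / 25^|w| > 0.  The total becomes (S + 2 s_k) / 5, which stays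
    positive because a vector of the cone e2 > 0, S > 0 has all its
    coordinates above - S / 2 ([cone_coord]).

    For sharpness, S has to outgrow 5^-|w|.  Along the words 0^n the largest
    eigenvalue 9/15 of M_0 takes over, so that S is of order (9/15)^n and
    e2(s) / S^2 is of order 9^-n ([total_nseq0]). *)

Set Implicit Arguments.
Unset Strict Implicit.
Unset Printing Implicit Defensive.

Import Order.TTheory GRing.Theory Num.Theory.

Local Open Scope classical_set_scope.
Local Open Scope ring_scope.

Definition col_sum (R : realType) (w : seq 'I_3) (j : 'I_3) : R :=
  \sum_(i < 3) M_word R w i j.

Definition total (R : realType) (s : 'I_3 -> R) : R := \sum_(j < 3) s j.

Definition e2 (R : realType) (s : 'I_3 -> R) : R :=
  s 0 * s 1 + s 1 * s 2 + s 2 * s 0.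

Lemma sum3E (R : realType) (f : 'I_3 -> R) : \sum_(i < 3) f i = f 0 + f 1 + f 2.
Proof.
rewrite !big_ord_recl big_ord0 addr0 addrA.
by congr (f _ + f _ + f _); apply: val_inj.
Qed.

Lemma ord3P (k : 'I_3) : [\/ k = 0, k = 1 | k = 2].
Proof.
case: k => [[|[|[|//]]] k_lt3].
- by apply: Or31; apply: val_inj.
- by apply: Or32; apply: val_inj.
- by apply: Or33; apply: val_inj.
Qed.

Lemma col_sum_nil (R : realType) (j : 'I_3) : col_sum R [::] j = 1.
Proof.
rewrite /col_sum /M_word big_nil sum3E !mxE.
by case: (ord3P j) => -> /=; rewrite ?addr0 ?add0r.
Qed.

Lemma col_sum_rcons (R : realType) (w : seq 'I_3) (k j : 'I_3) :
  col_sum R (rcons w k) j = \sum_(i < 3) col_sum R w i * M_letter R k i j.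
Proof.
rewrite /col_sum /M_word -cats1 big_cat big_seq1 /=.
under eq_bigr do rewrite mxE.
by rewrite exchange_big; apply: eq_bigr => i _; rewrite mulr_suml.
Qed.

Lemma total_col_sum_rcons (R : realType) (w : seq 'I_3) (k : 'I_3) :
  total (col_sum R (rcons w k)) =
  (total (col_sum R w) + 2 * col_sum R w k) / 5.
Proof.
rewrite /total !sum3E !col_sum_rcons !sum3E.
by case: (ord3P k) => ->; rewrite /M_letter /= !mxE /=; field.
Qed.

(** Each letter is a similarity of the quadratic form [e2]; for M_0 this is the
    identity (9 x + 2 (y + z)) (y + z) + (2 y - z) (2 z - y)
    = 9 (x y + y z + z x), where 9 / 15^2 = 1 / 25. *)
Lemma e2_col_sum_rcons (R : realType) (w : seq 'I_3) (k : 'I_3) :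
  e2 (col_sum R (rcons w k)) = e2 (col_sum R w) / 25.
Proof.
rewrite /e2 !col_sum_rcons !sum3E.
by case: (ord3P k) => ->; rewrite /M_letter /= !mxE /=; field.
Qed.

Lemma e2_col_sum (R : realType) (w : seq 'I_3) :
  e2 (col_sum R w) = 3 / 25 ^+ size w.
Proof.
elim/last_ind: w => [|w k IHw].
  by rewrite /e2 !col_sum_nil expr0; field.
rewrite e2_col_sum_rcons IHw size_rcons exprSr.
by field; rewrite expf_neq0 // pnatr_eq0.
Qed.

Lemma e2_col_sum_gt0 (R : realType) (w : seq 'I_3) : 0 < e2 (col_sum R w).
Proof. by rewrite e2_col_sum divr_gt0 ?exprn_gt0. Qed.

(** If 3 x + y + z <= 0 < x + y + z then x < 0, hence 4 x + y + z < 0 < y + z,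
    and 4 (x y + y z + z x) = (y + z) (4 x + y + z) - (y - z)^2 < 0. *)
Lemma cone_coord (R : realType) (x y z : R) :
  0 < x + y + z -> 0 < x * y + y * z + z * x -> 0 < 3 * x + y + z.
Proof.
move=> S_gt0 e2_gt0; rewrite ltNge; apply/negP => le0.
have neg : (y + z) * (4 * x + y + z) <= 0.
  by apply: mulr_ge0_le0; lra.
have := sqr_ge0 (y - z); nra.
Qed.

(** The all-ones vector lies in the cone where [e2] and [total] are positive,
    and every letter maps this cone into itself. *)
Lemma total_col_sum_gt0 (R : realType) (w : seq 'I_3) :
  0 < total (col_sum R w).
Proof.
elim/last_ind: w => [|w k]; first by rewrite /total sum3E !col_sum_nil; lra.
rewrite total_col_sum_rcons /total sum3E.
have := e2_col_sum_gt0 R w; rewrite /e2.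
set x := col_sum R w 0; set y := col_sum R w 1; set z := col_sum R w 2.
move=> e2_gt0 S_gt0; apply: divr_gt0 => //.
have [] : [/\ 0 < 3 * x + y + z, 0 < 3 * y + z + x & 0 < 3 * z + x + y].
  by split; apply: cone_coord; lra.
by case: (ord3P k) => ->; rewrite -/x -/y -/z; lra.
Qed.

Lemma spreadE (R : realType) (w : seq 'I_3) :
  \sum_(j < 3) (b R w j - 1 / 3) ^+ 2 =
  1 / 6 - e2 (col_sum R w) / (2 * total (col_sum R w) ^+ 2).
Proof.
have := total_col_sum_gt0 R w; rewrite sum3E /b exchange_big /=.
rewrite -/(total (col_sum R w)) -!/(col_sum R w _) /e2 /total sum3E.
by move=> /lt0r_neq0 S_neq0; field.
Qed.

Lemma spread_lt (R : realType) (w : seq 'I_3) :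
  \sum_(j < 3) (b R w j - 1 / 3) ^+ 2 < 1 / 6.
Proof.
rewrite spreadE ltrBlDr ltrDl divr_gt0 ?e2_col_sum_gt0 //.
by rewrite mulr_gt0 ?exprn_gt0 ?total_col_sum_gt0.
Qed.

(** On the words 0^n the last two column sums agree, and (1, 1, 1) splits as
    (3/2, 0, 0) + (-1/2, 1, 1), a sum of left eigenvectors of M_0 for the
    eigenvalues 9/15 and 1/15. *)
Lemma col_sum_nseq0 (R : realType) (n : nat) :
  [/\ col_sum R (nseq n 0) 0 = (3 * 9 ^+ n - 1) / (2 * 15 ^+ n),
      col_sum R (nseq n 0) 1 = 1 / 15 ^+ n
    & col_sum R (nseq n 0) 2 = 1 / 15 ^+ n].
Proof.
elim: n => [|n [IH0 IH1 IH2]]; first by rewrite !col_sum_nil !expr0; split; field.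
have -> : nseq n.+1 0 = rcons (nseq n 0) (0 : 'I_3).
  by rewrite -cats1 -(addn1 n) nseqD.
have nz : (15 : R) ^+ n != 0 by rewrite expf_neq0 // pnatr_eq0.
rewrite !col_sum_rcons !sum3E IH0 IH1 IH2 /M_letter /= !mxE /= !exprS.
by split; field.
Qed.

Lemma total_nseq0 (R : realType) (n : nat) :
  total (col_sum R (nseq n 0)) = 3 / 2 * (9 ^+ n + 1) / 15 ^+ n.
Proof.
have [H0 H1 H2] := col_sum_nseq0 R n.
rewrite /total sum3E H0 H1 H2.
by field; rewrite expf_neq0 // pnatr_eq0.
Qed.

Lemma spread_nseq0 (R : realType) (n : nat) :
  \sum_(j < 3) (b R (nseq n 0) j - 1 / 3) ^+ 2 =
  1 / 6 - 2 / 3 * 9 ^+ n / (9 ^+ n + 1) ^+ 2.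
Proof.
have pos9 : 0 < (9 : R) ^+ n by rewrite exprn_gt0.
have nz (m : nat) : (m.+1%:R : R) ^+ n != 0 by rewrite expf_neq0 // pnatr_eq0.
have [H0 H1 H2] := col_sum_nseq0 R n.
rewrite spreadE total_nseq0 /e2 H0 H1 H2.
by field; rewrite nz lt0r_neq0 ?addr_gt0.
Qed.

Theorem theorem6p5 (R : realType) :
  (forall w : seq 'I_3, \sum_(j < 3) (b R w j - 1 / 3) ^+ 2 < 1 / 6) /\
  sup [set \sum_(j < 3) (b R w j - 1 / 3) ^+ 2 | w in [set: seq 'I_3]] = 1 / 6.
Proof.
split; first exact: spread_lt.
set A := [set _ | _ in _].
have ubA : ubound A (1 / 6) by move=> _ [w _ <-]; apply/ltW/spread_lt.
have A0 : A !=set0 by eexists; exists [::].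
apply/eqP; rewrite eq_le ge_sup //=.
apply/ler_addgt0Pr => e e_gt0.
(* The gap to 1/6 on the word 0^n is below 9^-n < 1/n, so n > 1/e suffices. *)
pose n := Num.bound e^-1.
have n_gt : 1 < e * 9 ^+ n.
  rewrite mulrC -ltr_pdivrMr // div1r.
  apply: lt_trans (archi_boundP _) _; first by rewrite invr_ge0 ltW.
  by rewrite -natrX ltr_nat ltn_expl.
have : \sum_(j < 3) (b R (nseq n 0) j - 1 / 3) ^+ 2 <= sup A.
  by apply: ub_le_sup; [exists (1 / 6) | exists (nseq n 0)].
rewrite spread_nseq0.
suff : 2 / 3 * 9 ^+ n / (9 ^+ n + 1) ^+ 2 <= e by lra.
have pos9 : 0 < (9 : R) ^+ n by rewrite exprn_gt0.
rewrite ler_pdivrMr; last by rewrite exprn_gt0 ?addr_gt0.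
nra.
Qed.
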